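(* For each $\kappa \in (-\infty,\infty)$, let $$B_\kappa := \left\{ x \in (0,1] : \frac{d_{n+1}(x)}{d_n(x)} \leq \kappa \text{ for all } n \in \mathbb{N} \right\}.$$ Then $\dim_H B_\kappa = 1$ if $\kappa \in (1,\infty)$, and $\dim_H B_\kappa = 0$ if $\kappa \in (-\infty,1]$, because in the latter case $B_\kappa = \varnothing$.
   Context: Pierce expansion digits: for $x \in (0,1]$ put $d_1(x) := \lfloor 1/x \rfloor$ and $T(x) := 1 - d_1(x)x$, and for $k \in \mathbb{N}$ put $d_k(x) := d_1(T^{k-1}(x))$ provided $T^{k-1}(x) \neq 0$. All digits $d_k(x)$, $k \in \mathbb{N}$, are defined exactly when $x$ is irrational, and then they form a strictly increasing sequence of positive integers. Convention: a limiting condition on $(d_n(x))_n$, or a condition for all (large) $n$, is only considered for irrational $x$, so rational $x$ do not belong to sets defined by such conditions. $\mathbb{N}=\{1,2,\dots\}$, and $\dim_H$ is the Hausdorff dimension (with $\dim_H \varnothing = 0$). *)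

(* Defs.v *)
From mathcomp Require Import all_boot all_order all_algebra.
From mathcomp Require Import all_classical all_reals all_analysis.

Set Implicit Arguments.
Unset Strict Implicit.
Unset Printing Implicit Defensive.

Import Order.TTheory GRing.Theory Num.Theory.
Local Open Scope classical_set_scope.
Local Open Scope ring_scope.

Section Hausdorff.
Context {R : realType}.
Implicit Types (A : set R) (s delta : R).

(* The supremum is taken in [0, +oo], so that diam set0 = 0. *)
Definition diam A : \bar R :=
  ereal_sup ([set 0%E] `|` [set `|p.1 - p.2|%:E | p in A `*` A]).

(* The empty set has weight 0 also when s = 0, where 0 `^ 0 = 1: thus
   sequences of sets also encode finite covers, and the 0-dimensional
   Hausdorff measure is the counting measure. *)
Definition hausdorff_weight s A : \bar R :=
  if `[< A = set0 >] then 0%E else (diam A `^ s)%E.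

Definition delta_cover delta A (U : nat -> set R) : Prop :=
  A `<=` \bigcup_k U k /\ forall k, (diam (U k) <= delta%:E)%E.

Definition hausdorff_premeasure s delta A : \bar R :=
  ereal_inf [set (\sum_(0 <= k <oo) hausdorff_weight s (U k))%E |
             U in delta_cover delta A].

Definition hausdorff_measure s A : \bar R :=
  ereal_sup [set hausdorff_premeasure s delta A | delta in [set d | 0 < d]].

Definition hausdorff_dim A : \bar R :=
  ereal_inf [set s%:E | s in [set s | 0 <= s /\ hausdorff_measure s A = 0%E]].

End Hausdorff.

Section Pierce.
Context {R : realType}.
Implicit Types (x kappa : R).

Definition pierce_d1 x : int := Num.floor (1 / x).

(* Extended by 0 at 0, so that once an iterate vanishes all later ones do. *)
Definition pierce_T x : R := if x == 0 then 0 else 1 - (pierce_d1 x)%:~R * x.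

(* Indexed from k = 1. An undefined digit, i.e. one for which the iterate
   is 0, gets the value floor (1 / 0) = 0. *)
Definition pierce_digit (k : nat) x : int := pierce_d1 (iter k.-1 pierce_T x).

(* Irrationality says that all the digits of x are defined. *)
Definition pierce_ratio_le kappa : set R :=
  [set x | [/\ 0 < x <= 1, irrational x &
    forall n : nat, (1 <= n)%N ->
      (pierce_digit n.+1 x)%:~R / (pierce_digit n x)%:~R <= kappa]].

End Pierce.

(* Main.v *)
Require Import Defs.
From mathcomp Require Import all_boot all_order all_algebra.
From mathcomp Require Import all_classical all_reals all_analysis.
From mathcomp Require Import ring lra zify.

Import Order.TTheory GRing.Theory Num.Theory.
Import numFieldNormedType.Exports.
Local Open Scope classical_set_scope.
Local Open Scope ring_scope.

(** If [kappa <= 1] the set is empty, because the first two digits of an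
irrational number already satisfy [d_2 > d_1] ([pierce_digit2_gt]).

Let [kappa > 1].  A subset of the unit interval has dimension at most 1
([hausdorff_dim_le1]), so the point is to show that the [s]-dimensional
measure is nonzero for every [s < 1].  Fix an exponent [p = r + 2] and a large
base point [M], and consider only the numbers whose [k]-th digit, counted from
0, lies in the block of [(M + k)^(p-1)] consecutive integers starting at
[(M + k)^p].  These blocks are disjoint and increasing, so every choice of one
digit per block is the digit sequence of an irrational number, the sum of the
Pierce series [1/d_0 - 1/(d_0 d_1) + ...].  Since the blocks grow polynomially,
the ratio of consecutive digits is at most [((M + k + 2) / (M + k))^p], which is
below [kappa] uniformly in [k] once [M] is large ([block_ratio]).  On the other
hand the number of choices [(M + k)^(p-1)] is the power [1 - 1/p] of the size of
the digits, which is why the dimension comes close to 1 when [p] is large.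

The dimension estimate avoids the construction of a measure.  Expand
[u] in [[0, 1)] in the mixed radix system with bases [(M + k)^(p-1)], and let
[g u] be the number whose digits occupy the corresponding places in the blocks.
If the expansions of [u] and [v] first differ at place [n], then [|u - v|] is at
most the inverse of the product of the first [n] bases ([radix_dist_le]), while
[|g u - g v|] is at least the inverse of the product of the first [n] digits, up
to a few further digits ([pierce_sum_separation]).  These extra factors are
polynomial in [n], hence negligible against [M (M + 1) ... (M + n - 1)]
([poly_le_rising]).  So [|u - v| <= C |g u - g v|^s] ([block_holder]), and a
cover of the image of [g] by sets [U_k] pulls back to a cover of [[0, 1)] by
sets of diameter at most [C (diam U_k)^s]; by subadditivity of the Lebesgue
measure the sum of [(diam U_k)^s] stays away from 0
([hausdorff_measure_holder_image]). *)

(** * Hausdorff measure and dimension on the line *)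

Section HausdorffBounds.
Context {R : realType}.
Implicit Types (A : set R) (s delta : R).

Lemma diam_ge0 A : (0 <= diam A)%E.
Proof. by apply: ereal_sup_ubound; left. Qed.

Lemma dist_le_diam A x y : A x -> A y -> (`|x - y|%:E <= diam A)%E.
Proof. by move=> Ax Ay; apply: ereal_sup_ubound; right; exists (x, y). Qed.

Lemma diam_le A (d : R) : 0 <= d ->
  (forall x y, A x -> A y -> `|x - y| <= d) -> (diam A <= d%:E)%E.
Proof.
move=> d0 Ad; apply: ge_ereal_sup => _ [->|[[x y] /= [Ax Ay] <-]].
  by rewrite lee_fin.
by rewrite lee_fin Ad.
Qed.

Lemma hausdorff_weight_ge0 s A : (0 <= hausdorff_weight s A)%E.
Proof.
rewrite /hausdorff_weight; case: asboolP => // _.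
exact: poweR_ge0.
Qed.

Lemma hausdorff_weight_set0 s : hausdorff_weight s (set0 : set R) = 0%E.
Proof. by rewrite /hausdorff_weight; case: asboolP. Qed.

Lemma hausdorff_weight_le s A (d : R) : 0 <= s -> 0 <= d ->
  (forall x y, A x -> A y -> `|x - y| <= d) ->
  (hausdorff_weight s A <= (d `^ s)%:E)%E.
Proof.
move=> s0 d0 Ad; rewrite /hausdorff_weight; case: asboolP => _.
  by rewrite lee_fin powR_ge0.
rewrite -poweR_EFin; apply: gt0_ler_poweR => //.
- by rewrite in_itv/= diam_ge0 leey.
- by rewrite in_itv/= lee_fin d0 leey.
- exact: diam_le.
Qed.

Lemma hausdorff_premeasure_ge0 s delta A :
  (0 <= hausdorff_premeasure s delta A)%E.
Proof.
apply: le_ereal_inf_tmp => _ [U _ <-]; apply: nneseries_ge0 => k _ _.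
exact: hausdorff_weight_ge0.
Qed.

Lemma hausdorff_premeasure_le_measure s delta A : 0 < delta ->
  (hausdorff_premeasure s delta A <= hausdorff_measure s A)%E.
Proof. by move=> d0; apply: ereal_sup_ubound; exists delta. Qed.

Lemma hausdorff_measure_eq0 s A :
  (forall delta e : R, 0 < delta -> 0 < e ->
     (hausdorff_premeasure s delta A <= e%:E)%E) ->
  hausdorff_measure s A = 0%E.
Proof.
move=> h; apply/eqP; rewrite eq_le; apply/andP; split.
  apply: ge_ereal_sup => _ [delta /= d0 <-].
  by apply/lee_addgt0Pr => e e0; rewrite add0e h.
apply: le_trans (hausdorff_premeasure_ge0 s 1 A) _.
exact: hausdorff_premeasure_le_measure ltr01.
Qed.

Lemma hausdorff_dim_ge0 A : (0 <= hausdorff_dim A)%E.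
Proof. by apply: le_ereal_inf_tmp => _ [s [s0 _] <-]; rewrite lee_fin. Qed.

Lemma hausdorff_dim_set0 : hausdorff_dim (set0 : set R) = 0%E.
Proof.
apply/eqP; rewrite eq_le hausdorff_dim_ge0 andbT.
apply: ereal_inf_lbound; exists 0 => //; split => //.
apply: hausdorff_measure_eq0 => delta e d0 e0.
apply: (@le_trans _ _ 0%E); last by rewrite lee_fin ltW.
apply: ereal_inf_lbound; exists (fun=> set0).
  by split=> // k; apply: diam_le => //; exact: ltW.
by rewrite eseries0// => k _ _; exact: hausdorff_weight_set0.
Qed.

(** The unit interval is cut into [n] intervals of length [1/n], of total weight
[n * n^(-s) = n^(1-s)], which tends to 0. *)
Lemma hausdorff_measure_unit s A : 1 < s -> A `<=` `[0, 1[ ->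
  hausdorff_measure s A = 0%E.
Proof.
move=> s1 A01; apply: hausdorff_measure_eq0 => delta e d0 e0.
have s0 : 0 <= s by apply: le_trans (ltW s1).
have s10 : 0 < s - 1 by rewrite subr_gt0.
(* The total weight of the pieces of length h will be h `^ (s - 1), and the
   second bound on h is h `^ (s - 1) <= e solved for h. *)
have [n nP] : exists n : nat,
    (n.+1%:R : R)^-1 <= Num.min delta (e `^ (s - 1)^-1).
  set m := Num.min _ _; have m0 : 0 < m by rewrite lt_min d0 powR_gt0.
  exists (Num.truncn m^-1); rewrite invf_ple ?posrE ?ltr0n//.
  exact/ltW/truncnS_gt.
set h := (n.+1%:R : R)^-1 in nP.
have h0 : 0 < h by rewrite invr_gt0 ltr0n.
move: nP; rewrite le_min => /andP[hd he].
have hs : h `^ (s - 1) <= e.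
  have -> : e = (e `^ (s - 1)^-1) `^ (s - 1).
    by rewrite -powRrM mulVf ?gt_eqF// powRr1// ltW.
  by apply: ge0_ler_powR => //; rewrite ?nnegrE ?powR_ge0// ltW.
pose U k := if (k < n.+1)%N then [set x : R | k%:R * h <= x < k.+1%:R * h]
            else set0.
have Uh k x y : U k x -> U k y -> `|x - y| <= h.
  rewrite /U; case: ifP => // _ /=; rewrite mulrSr mulrDl mul1r.
  move=> /andP[? ?] /andP[? ?]; rewrite ler_norml; apply/andP; split; lra.
apply: (@le_trans _ _ (\sum_(0 <= k <oo) hausdorff_weight s (U k))%E).
  apply: ereal_inf_lbound; exists U => //; split; last first.
    move=> k; apply: (@le_trans _ _ h%:E); last by rewrite lee_fin.
    by apply: diam_le; [exact: ltW | exact: Uh].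
  move=> x /A01 /=; rewrite in_itv/= => /andP[x0 x1].
  exists (Num.truncn (x / h)) => //.
  have xh0 : 0 <= x / h by rewrite divr_ge0// ltW.
  have /andP[t1 t2] := truncn_itv xh0.
  rewrite /U truncn_lt_nat//.
  have -> : x / h < n.+1%:R by rewrite /h invrK gtr_pMl ?ltr0n.
  by rewrite /= -ler_pdivlMr// t1 -ltr_pdivrMr.
rewrite (nneseries_split 0 n.+1); last first.
  by move=> k _; exact: hausdorff_weight_ge0.
rewrite [X in (_ + X)%E]eseries0 ?adde0; last first.
  by move=> k nk _; rewrite /U ltnNge nk hausdorff_weight_set0.
apply: (@le_trans _ _ (\sum_(0 <= k < n.+1) (h `^ s)%:E)%E).
  apply: lee_sum => k _; apply: hausdorff_weight_le => //; first exact: ltW.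
  exact: Uh.
rewrite sumEFin lee_fin sumr_const_nat subn0 -mulr_natl.
apply: le_trans hs; rewrite -(mulr_powRB1 (ltW h0) (lt_trans ltr01 s1)).
by rewrite mulrA divff ?pnatr_eq0// mul1r.
Qed.

Lemma hausdorff_dim_le1 A : A `<=` `[0, 1[ -> (hausdorff_dim A <= 1)%E.
Proof.
move=> A01; apply/lee_addgt0Pr => e e0; apply: ereal_inf_lbound.
exists (1 + e) => //; split; first by rewrite addr_ge0// ltW.
by apply: hausdorff_measure_unit A01; rewrite ltrDl.
Qed.

(** A substitute for the mass distribution principle: the inverse of [g] is
Hölder continuous with exponent [s], so it turns a cover of [A] of small total
weight into a cover of the unit interval of small total length. *)
Lemma hausdorff_measure_holder_image s A (g : R -> R) (C : R) :
  0 <= s -> 0 < C -> (forall u : R, 0 <= u < 1 -> A (g u)) ->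
  (forall u v : R, 0 <= u < 1 -> 0 <= v < 1 -> u != v ->
     `|u - v| <= C * `|g u - g v| `^ s) ->
  hausdorff_measure s A != 0%E.
Proof.
move=> s0 C0 gA gC; apply/negP => /eqP H0.
have : (hausdorff_premeasure s 1 A < (2 * C)^-1%:E)%E.
  apply: (@le_lt_trans _ _ 0%E); last by rewrite lte_fin invr_gt0 mulr_gt0.
  by rewrite -H0 hausdorff_premeasure_le_measure.
move=> /ereal_inf_lt[_ [U [AU Ud] <-]]; apply/negP; rewrite -leNgt.
pose D k := fine (diam (U k)).
have DE k : diam (U k) = (D k)%:E.
  rewrite fineK// ge0_fin_numE ?diam_ge0//.
  by apply: le_lt_trans (Ud k) _; rewrite ltry.
pose V k := [set u : R | 0 <= u < 1 /\ U k (g u)].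
pose w k := C * D k `^ s.
have w0 k : 0 <= w k by rewrite mulr_ge0 ?powR_ge0// ltW.
have Vw k u v : V k u -> V k v -> `|u - v| <= w k.
  move=> [u01 Uu] [v01 Uv]; have [->|uv] := eqVneq u v.
    by rewrite subrr normr0.
  apply: le_trans (gC _ _ u01 v01 uv) _; rewrite ler_pM2l//.
  have := dist_le_diam _ _ _ Uu Uv; rewrite DE lee_fin => dD.
  by apply: ge0_ler_powR => //; rewrite nnegrE //; apply: le_trans dD.
(* Each set of the pulled back cover is enclosed in an interval twice as long
   as its diameter, so that the Lebesgue measure applies to it. *)
have /choice[I IP] k : exists J : interval R, V k `<=` [set` J] /\
    (lebesgue_measure [set` J] <= (2 * C)%:E * hausdorff_weight s (U k))%E.
  have [->|/set0P[v Vv]] := eqVneq (V k) set0.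
    exists `]0, 0[; split=> //; rewrite set_itvoo0 measure0.
    by rewrite mule_ge0 ?hausdorff_weight_ge0// lee_fin mulr_ge0// ltW.
  exists `[v - w k, v + w k]; split.
    move=> u Vu /=; have := Vw _ _ _ Vu Vv.
    by rewrite in_itv/= ler_distl.
  rewrite lebesgue_measure_itv/= /hausdorff_weight; case: asboolP => [U0|_].
    by move: Vv => []; rewrite U0.
  rewrite DE poweR_EFin -EFinM -mulrA -/(w k).
  case: ifPn => _; last by rewrite lee_fin mulr_ge0.
  by rewrite -EFinD lee_fin; lra.
have cov : `[0, 1[%classic `<=` \bigcup_k [set` I k].
  move=> u /=; rewrite in_itv/= => u01; have [k _ Uk] := AU _ (gA _ u01).
  by exists k => //; apply: (IP k).1.
have /= := @measure_sigma_subadditive _ _ _ (@lebesgue_measure R) _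
  (fun k => [set` I k]) (fun=> measurable_itv _) (measurable_itv _) cov.
rewrite lebesgue_measure_itv/= lte_fin ltr01 sube0 => leb.
have : (1 <= (2 * C)%:E * \sum_(0 <= k <oo) hausdorff_weight s (U k))%E.
  rewrite -nneseriesZl; last by move=> k _; exact: hausdorff_weight_ge0.
  apply: le_trans leb _; apply: lee_nneseries => k *; first exact: measure_ge0.
  exact: (IP k).2.
by rewrite muleC -lee_pdivrMr ?mulr_gt0// mul1e.
Qed.

Lemma hausdorff_dim_ge1 A :
  (forall s, 0 <= s < 1 -> hausdorff_measure s A != 0%E) ->
  (1 <= hausdorff_dim A)%E.
Proof.
move=> h; apply: le_ereal_inf_tmp => _ [s [s0 Hs] <-]; rewrite lee_fin leNgt.
by apply/negP => s1; have := h s; rewrite s0 s1 Hs eqxx => /(_ isT).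
Qed.

End HausdorffBounds.

(** * Pierce expansions *)

Section PierceDigits.
Context {R : realType}.
Implicit Types (x y : R) (d e : nat -> nat).

(** On fractions [pierce_T] is a step of the Euclidean algorithm: it maps
[a / b] to [(b mod a) / b], whose numerator is smaller. *)
Lemma iter_pierce_T_natdiv (a b : nat) : (0 < b)%N ->
  exists n, iter n pierce_T (a%:R / b%:R) = 0 :> R.
Proof.
move=> b0; elim/ltn_ind: a => a IH.
have [->|a0] := posnP a; first by exists 0%N; rewrite /= mul0r.
have a0R : (0 : R) < a%:R by rewrite ltr0n.
have b0R : (0 : R) < b%:R by rewrite ltr0n.
have d1 : pierce_d1 (a%:R / b%:R : R) = (b %/ a)%:Z.
  rewrite /pierce_d1 div1r invf_div; apply: floor_def.
  rewrite -PoszD addn1 !pmulrn -?natrM ler_pdivlMr// ltr_pdivrMr//.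
  by rewrite -!natrM ler_nat ltr_nat leq_divM ltn_ceil.
have [n nP] := IH _ (ltn_pmod b a0); exists n.+1.
rewrite iterSr /pierce_T gt_eqF ?divr_gt0// d1 -[RHS]nP; congr (iter _ _ _).
rewrite pmulrn mulrA -natrM -{1}(divff (lt0r_neq0 b0R)) -mulrBl.
by rewrite {1}(divn_eq b a) natrD addrAC subrr add0r.
Qed.

Lemma iter_pierce_T_rational x : 0 <= x -> rational x ->
  exists n, iter n pierce_T x = 0.
Proof.
move=> x0 [q _ qx]; rewrite -qx; rewrite -qx ler0q in x0.
have -> : ratr q = `|numq q|%N%:R / `|denq q|%N%:R :> R.
  by rewrite !pmulrn !gez0_abs ?numq_ge0 ?denq_ge0.
by apply: iter_pierce_T_natdiv; rewrite absz_gt0 denq_neq0.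
Qed.

(** From [x > 1 / (d_1 + 1)] follows [T x = 1 - d_1 x < 1 / (d_1 + 1)];
irrationality excludes [T x = 0], so the second digit exceeds [d_1]. *)
Lemma pierce_digit2_gt x : 0 < x <= 1 -> irrational x ->
  0 < pierce_digit 1 x < pierce_digit 2 x.
Proof.
move=> /andP[x0 x1] irr; rewrite /pierce_digit /=.
have /andP[d1 d2] := floor_itv (1 / x); rewrite -/(pierce_d1 x) in d1 d2.
have d0 : 0 < pierce_d1 x by rewrite floor_gt0 div1r invf_ge1.
rewrite d0 /=.
have T1 : pierce_T x = 1 - (pierce_d1 x)%:~R * x by rewrite /pierce_T gt_eqF.
rewrite ler_pdivlMr// in d1; rewrite ltr_pdivrMr// in d2.
have T0 : 0 < pierce_T x.
  rewrite lt_neqAle T1 subr_ge0 d1 andbT; apply/eqP => T0.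
  apply: irr; exists (1 / (pierce_d1 x)%:Q) => //.
  have D0 : (pierce_d1 x)%:~R != 0 :> R by rewrite intr_eq0 gt_eqF.
  rewrite fmorph_div rmorph1 rmorph_int; apply: (mulfI D0).
  by rewrite mul1r mulfV//; lra.
rewrite -lezD1 /pierce_d1 -/(pierce_d1 x) floor_ge_int ler_pdivlMr// T1.
have D0 : 0 <= (pierce_d1 x)%:~R :> R by rewrite ler0z ltW.
move: d2; rewrite !intrD; set D := (pierce_d1 x)%:~R in d1 D0 * => d2.
by have := mulr_ge0 D0 (ltW (eqbRL (subr_gt0 _ _) d2)); lra.
Qed.

Definition pierce_term d (i : nat) : R :=
  (-1) ^+ i / (\prod_(k < i.+1) d k)%:R.

Definition pierce_sum d : R := limn (series (pierce_term d)).

Lemma pierce_term0 d : pierce_term d 0 = (d 0%N)%:R^-1.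
Proof. by rewrite /pierce_term big_ord1 expr0 div1r. Qed.

Lemma pierce_termS d i :
  pierce_term d i.+1 = - (pierce_term (fun k => d k.+1) i / (d 0%N)%:R).
Proof.
rewrite /pierce_term big_ord_recl natrM invfM exprS mulN1r mulNr.
by rewrite mulrA mulrAC.
Qed.

Lemma series_pierce_term d n : series (pierce_term d) n.+1 =
  (1 - series (pierce_term (fun k => d k.+1)) n) / (d 0%N)%:R.
Proof.
rewrite /series /= big_nat_recl// pierce_term0 mulrBl mul1r; congr (_ + _).
by under eq_bigr do rewrite pierce_termS; rewrite sumrN mulr_suml.
Qed.

Lemma is_cvg_pierce d : (forall k, (1 < d k)%N) ->
  cvgn (series (pierce_term d)).
Proof.
move=> d2; apply: normed_cvg.
apply: (@series_le_cvg _ _ (geometric 1 2^-1)) => [n|n|n|].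
- exact: normr_ge0.
- by rewrite /= mul1r exprn_ge0// invr_ge0.
- rewrite /= mul1r /pierce_term normrM normrX normrN1 expr1n mul1r normfV.
  rewrite normr_nat exprVn lef_pV2 ?posrE ?exprn_gt0 ?ltr0n//; last first.
    by rewrite prodn_gt0// => k; apply: ltnW.
  rewrite -natrX ler_nat -{1}[n]subn0 -prod_nat_const_nat big_mkord.
  rewrite (@leq_trans (\prod_(k < n) d k))//; first exact: leq_prod.
  by rewrite big_ord_recr /= leq_pmulr// ltnW.
- by apply: is_cvg_geometric_series; rewrite normfV normr_nat invf_lt1 ?ltr1n.
Qed.

(** The functional equation of the Pierce series, which also says that
[pierce_T] shifts the digits. *)
Lemma pierce_sum_rec d : (forall k, (1 < d k)%N) ->
  pierce_sum d = (1 - pierce_sum (fun k => d k.+1)) / (d 0%N)%:R.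
Proof.
move=> d2; apply/cvg_lim => //; rewrite -cvg_shiftS.
under eq_fun do rewrite series_pierce_term.
apply: cvgM; last exact: cvg_cst.
apply: cvgB; first exact: cvg_cst.
by apply: is_cvg_pierce => k; apply: d2.
Qed.


(** Weak bounds hold for the partial sums of any series with digits at least 2
and pass to the limit; the strict bounds below are bootstrapped from them. *)
Lemma pierce_sum_weak_bounds d : (forall k, (1 < d k)%N) ->
  0 <= pierce_sum d <= (d 0%N)%:R^-1.
Proof.
move=> d2; have cd := is_cvg_pierce d d2.
have S n : forall e, (forall k, (1 < e k)%N) ->
    0 <= series (pierce_term e) n <= (e 0%N)%:R^-1.
  elim: n => [|n IH] e e2.
    by rewrite /series /= big_geq// lexx invr_ge0 ler0n.
  have /andP[s0 s1] := IH (fun k => e k.+1) (fun k => e2 k.+1).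
  have e1 : (e 1%N)%:R^-1 <= 1 :> R.
    by have h := ltnW (e2 1%N); rewrite invf_le1 ?ler1n ?ltr0n.
  rewrite series_pierce_term; apply/andP; split.
    by rewrite divr_ge0// subr_ge0 (le_trans s1).
  by rewrite ler_piMl ?invr_ge0// gerBl.
apply/andP; split.
  by apply: limr_ge => //; near=> n; have /andP[] := S n d d2.
by apply: limr_le => //; near=> n; have /andP[] := S n d d2.
Unshelve. all: by end_near. Qed.

Lemma digit_gt1 d k : (1 < d 0%N)%N -> (forall k, (d k < d k.+1)%N) ->
  (1 < d k)%N.
Proof. by move=> d0 dS; elim: k => // k IH; apply: ltn_trans IH (dS k). Qed.

(** Each use of [pierce_sum_rec] turns a bound on one side for the shifted
sequence into a bound on the other side: positivity of all the tails gives the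
strict upper bound, which in turn gives the strict lower bound, where it matters
that [d 1] is at least [d 0 + 1]. *)
Lemma pierce_sum_bounds d : (1 < d 0%N)%N -> (forall k, (d k < d k.+1)%N) ->
  (d 0%N).+1%:R^-1 < pierce_sum d < (d 0%N)%:R^-1.
Proof.
move=> d0 dS; have d2 k := digit_gt1 d k d0 dS.
have gt0 e : (1 < e 0%N)%N -> (forall k, (e k < e k.+1)%N) -> 0 < pierce_sum e.
  move=> e0 eS; have e2 k := digit_gt1 e k e0 eS.
  rewrite pierce_sum_rec// divr_gt0 ?ltr0n ?(ltnW e0)// subr_gt0.
  have /andP[_ h] := pierce_sum_weak_bounds _ (fun k => e2 k.+1).
  by apply: le_lt_trans h _; rewrite invf_lt1 ?ltr1n ?ltr0n// ltnW.
have p k : (0 : R) < (d k)%:R by rewrite ltr0n ltnW.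
have lt1 e : (1 < e 0%N)%N -> (forall k, (e k < e k.+1)%N) ->
    pierce_sum e < (e 0%N)%:R^-1.
  move=> e0 eS; have e2 k := digit_gt1 e k e0 eS.
  rewrite pierce_sum_rec// ltr_pdivrMr ?ltr0n ?(ltnW e0)//.
  rewrite mulVf ?gt_eqF ?ltr0n ?(ltnW e0)//.
  by rewrite gtrBl gt0.
rewrite lt1// andbT pierce_sum_rec// ltr_pdivlMr//.
rewrite mulrC ltr_pdivrMr ?ltr0n// mulrBl mul1r.
have : pierce_sum (fun k => d k.+1) * (d 0%N).+1%:R < 1.
  rewrite -ltr_pdivlMr ?ltr0n// div1r.
  apply: lt_le_trans (lt1 (fun k => d k.+1) (d2 1%N) (fun k => dS k.+1)) _.
  by rewrite lef_pV2 ?posrE ?ltr0n// ?ler_nat ?dS// ltnW// d2.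
by rewrite -[(d 0%N).+1]addn1 natrD; lra.
Qed.

Lemma pierce_d1_sum d : (1 < d 0%N)%N -> (forall k, (d k < d k.+1)%N) ->
  pierce_d1 (pierce_sum d) = (d 0%N)%:Z.
Proof.
move=> d0 dS; have /andP[h1 h2] := pierce_sum_bounds d d0 dS.
have x0 : 0 < pierce_sum d by apply: lt_trans h1; rewrite invr_gt0 ltr0n.
have D0 : (0 : R) < (d 0%N)%:R by rewrite ltr0n ltnW.
apply: floor_def; rewrite -PoszD addn1 -!pmulrn div1r.
by rewrite -[X in X <= _]invrK -[X in _ < X]invrK lef_pV2 ?ltf_pV2 ?posrE
  ?invr_gt0 ?ltr0n ?(ltW h2)// ltnW.
Qed.

Lemma pierce_T_sum d : (1 < d 0%N)%N -> (forall k, (d k < d k.+1)%N) ->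
  pierce_T (pierce_sum d) = pierce_sum (fun k => d k.+1).
Proof.
move=> d0 dS; have /andP[h1 h2] := pierce_sum_bounds d d0 dS.
have x0 : 0 < pierce_sum d by apply: lt_trans h1; rewrite invr_gt0 ltr0n.
rewrite /pierce_T gt_eqF// pierce_d1_sum// pierce_sum_rec; last first.
  by move=> k; apply: digit_gt1.
by rewrite -pmulrn mulrC divfK ?subKr// gt_eqF// ltr0n ltnW.
Qed.

Lemma iter_pierce_T_sum d n : (1 < d 0%N)%N -> (forall k, (d k < d k.+1)%N) ->
  iter n pierce_T (pierce_sum d) = pierce_sum (fun k => d (n + k)%N).
Proof.
move=> d0 dS; elim: n => [//|n IH]; rewrite iterS IH pierce_T_sum.
- by congr pierce_sum; apply/funext => k; rewrite addnS.
- by apply: digit_gt1.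
- by move=> k /=; rewrite addnS.
Qed.

Lemma pierce_digit_sum d n : (1 < d 0%N)%N -> (forall k, (d k < d k.+1)%N) ->
  pierce_digit n.+1 (pierce_sum d) = (d n)%:Z.
Proof.
move=> d0 dS; rewrite /pierce_digit iter_pierce_T_sum// pierce_d1_sum ?addn0//.
- by apply: digit_gt1.
- by move=> k /=; rewrite addnS.
Qed.

(** All iterates of [pierce_T] are positive tails of the series, whereas for a
rational number they reach 0. *)
Lemma irrational_pierce_sum d : (1 < d 0%N)%N -> (forall k, (d k < d k.+1)%N) ->
  irrational (pierce_sum d).
Proof.
move=> d0 dS rat.
have gt0 n : 0 < pierce_sum (fun k => d (n + k)%N).
  have shS k : (d (n + k) < d (n + k.+1))%N by rewrite addnS.
  have /andP[h _] := pierce_sum_bounds (fun k => d (n + k)%N)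
    (digit_gt1 d (n + 0) d0 dS) shS.
  by apply: lt_trans h; rewrite invr_gt0 ltr0n.
have [n] := iter_pierce_T_rational _ (ltW (gt0 0%N)) rat.
by rewrite iter_pierce_T_sum// => h; have := gt0 n; rewrite h ltxx.
Qed.

(** Before the first difference the common digits only rescale the distance, by
[pierce_sum_rec].  At the first difference, say [d 0 < e 0], the two numbers lie
in different intervals [(1 / (j + 1), 1 / j]], which may be adjacent; the gap
between them comes from the next digit, since
[pierce_sum d >= (1 - 1 / d 1) / d 0] and [pierce_sum e <= 1 / e 0].  The
difference of these two bounds has denominator [d 0 * e 0 * d 1], and the
assumption [e 0 < d 1] makes its integral numerator positive. *)
Lemma pierce_sum_separation d e n :
  (forall k, (1 < d k)%N) -> (forall k, (1 < e k)%N) ->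
  (forall k, (k < n)%N -> d k = e k) -> (d n < e n)%N -> (e n < d n.+1)%N ->
  (\prod_(k < n) d k * (d n * e n * d n.+1))%:R^-1 <=
    `|pierce_sum d - pierce_sum e|.
Proof.
elim: n d e => [|n IH] d e d2 e2 de lt1 lt2.
  rewrite big_ord0 mul1n; apply: le_trans (ler_norm _).
  have /andP[_ hy] := pierce_sum_weak_bounds _ (fun k => d2 k.+1).
  have /andP[_ hz] := pierce_sum_weak_bounds _ e2.
  have d0 : (0 : R) < (d 0%N)%:R by rewrite ltr0n ltnW.
  have d1 : (0 : R) < (d 1%N)%:R by rewrite ltr0n ltnW.
  have e0 : (0 : R) < (e 0%N)%:R by rewrite ltr0n ltnW.
  apply: (@le_trans _ _ ((1 - (d 1%N)%:R^-1) / (d 0%N)%:R - (e 0%N)%:R^-1)).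
    have h1 : (d 0%N)%:R + 1 <= (e 0%N)%:R :> R by rewrite natr1 ler_nat.
    have h2 : (e 0%N)%:R + 1 <= (d 1%N)%:R :> R by rewrite natr1 ler_nat.
    rewrite !natrM; move: d0 d1 e0 h1 h2; set a := (d 0%N)%:R.
    set b := (e 0%N)%:R; set c := (d 1%N)%:R => a0 c0 b0 ab bc.
    have -> : (1 - c^-1) / a - b^-1 = (b * c - b - a * c) / (a * b * c).
      by field; rewrite !gt_eqF.
    rewrite -[X in X <= _]mul1r ler_pM2r ?invr_gt0 ?mulr_gt0//.
    have := mulr_ge0 (ltW c0) (eqbRL (subr_ge0 _ _) ab); lra.
  by rewrite lerB// pierce_sum_rec// ler_pM2r ?invr_gt0// lerB.
have -> : pierce_sum d - pierce_sum e = - ((pierce_sum (fun k => d k.+1) -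
    pierce_sum (fun k => e k.+1)) / (d 0%N)%:R).
  rewrite (pierce_sum_rec d)// (pierce_sum_rec e)// de// -mulrBl -mulNr.
  by congr (_ / _); lra.
rewrite normrN normrM normfV normr_nat big_ord_recl -mulnA natrM invfM mulrC.
rewrite ler_pM2r ?invr_gt0 ?ltr0n 1?ltnW//; apply: IH => // k kn.
by apply: (de k.+1).
Qed.

End PierceDigits.

(** * Mixed radix expansions *)

Section MixedRadix.
Context {R : realType}.
Context (m : nat -> nat) (m_gt1 : forall k, (1 < m k)%N).
Implicit Types u v : R.

(** The part of [u] that remains after [n] digits, rescaled to the unit
interval. *)
Fixpoint radix_rem u (n : nat) : R :=
  if n is k.+1 then
    (m k)%:R * radix_rem u k - (Num.truncn ((m k)%:R * radix_rem u k))%:R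
  else u.

Definition radix_digit u (n : nat) : nat :=
  Num.truncn ((m n)%:R * radix_rem u n).

Lemma radix_rem_itv u n : 0 <= u < 1 -> 0 <= radix_rem u n < 1.
Proof.
move=> u01; elim: n => [//|n /andP[IH _]] /=.
have /truncn_itv /andP[h1 h2] : 0 <= (m n)%:R * radix_rem u n.
  by rewrite mulr_ge0.
by rewrite subr_ge0 h1 ltrBlDr addrC natr1.
Qed.

Lemma radix_digit_lt u n : 0 <= u < 1 -> (radix_digit u n < m n)%N.
Proof.
move=> /(radix_rem_itv u n)/andP[h0 h1].
rewrite /radix_digit truncn_lt_nat; last by rewrite mulr_ge0.
by rewrite gtr_pMr// ltr0n ltnW.
Qed.

Lemma radix_remB u v n :
  (forall k, (k < n)%N -> radix_digit u k = radix_digit v k) ->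
  radix_rem u n - radix_rem v n = (\prod_(k < n) m k)%:R * (u - v).
Proof.
elim: n => [|n IH] uv; first by rewrite big_ord0 mul1r.
rewrite /= -!/(radix_digit _ _) uv// opprB addrA subrK -mulrBr IH; last first.
  by move=> k /ltnW; exact: uv.
by rewrite big_ord_recr /= natrM mulrA [(m n)%:R * _]mulrC.
Qed.

Lemma radix_dist_le u v n : 0 <= u < 1 -> 0 <= v < 1 ->
  (forall k, (k < n)%N -> radix_digit u k = radix_digit v k) ->
  `|u - v| <= (\prod_(k < n) m k)%:R^-1.
Proof.
move=> u01 v01 uv; have /andP[u0 u1] := radix_rem_itv u n u01.
have /andP[v0 v1] := radix_rem_itv v n v01.
have P0 : (0 : R) < (\prod_(k < n) m k)%:R.
  by rewrite ltr0n prodn_gt0// => k; exact: ltnW.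
rewrite -[X in _ <= X]mul1r ler_pdivlMr// -[X in _ * X]gtr0_norm// -normrM.
by rewrite mulrC -radix_remB// ler_norml; apply/andP; split; lra.
Qed.

(** If all the digits agreed, [radix_dist_le] would bound the distance by
[2^(-n)] for every [n]. *)
Lemma radix_first_diff u v : 0 <= u < 1 -> 0 <= v < 1 -> u != v ->
  exists2 n, (forall k, (k < n)%N -> radix_digit u k = radix_digit v k) &
             radix_digit u n != radix_digit v n.
Proof.
move=> u01 v01 uv.
have [n0 ne] : exists n, radix_digit u n != radix_digit v n.
  apply: contrapT => /forallNP eqd.
  have {}eqd n : radix_digit u n = radix_digit v n.
    by apply/eqP; have /negP := eqd n; rewrite negbK.
  have uv0 : 0 < `|u - v| by rewrite normr_gt0 subr_eq0.
  set n := Num.bound `|u - v|^-1.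
  have := radix_dist_le u v n u01 v01 (fun k _ => eqd k).
  rewrite leNgt => /negP; apply.
  have h := upper_nthrootP (leqnn n).
  rewrite -[X in _ < X]invrK ltf_pV2 ?posrE ?invr_gt0//.
    apply: lt_le_trans h _; rewrite -natrX ler_nat -{1}[n]subn0.
    by rewrite -prod_nat_const_nat big_mkord leq_prod.
  by rewrite ltr0n prodn_gt0// => k; exact: ltnW.
have [n nP nmin] :=
  ex_minnP (ex_intro (fun n => radix_digit u n != radix_digit v n) n0 ne).
exists n => // k kn; apply/eqP; apply: contraTT kn => /nmin.
by rewrite -leqNgt.
Qed.

End MixedRadix.

(** * Numbers with digits in polynomially growing blocks *)

Lemma leq_wexp2r K (a b : nat) : (a <= b)%N -> (a ^ K <= b ^ K)%N.
Proof. by case: K => // K ab; rewrite leq_exp2r. Qed.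

(** When [n] grows by 1 the left side grows by a factor at most [2^K], and the
right side by [M + n]; the latter wins from [n = 2^K] on, and the constant takes
care of the smaller values of [n]. *)
Lemma poly_le_rising K c M : (0 < M)%N -> exists2 C, (0 < C)%N &
  forall n, ((c + n) ^ K <= C * \prod_(k < n) (M + k))%N.
Proof.
move=> M0; exists ((c + 2 ^ K).+1 ^ K)%N; first by rewrite expn_gt0.
have P0 n : (0 < \prod_(k < n) (M + k))%N.
  by rewrite prodn_gt0// => k; rewrite addn_gt0 M0.
elim=> [|n IH].
  by rewrite big_ord0 muln1 leq_wexp2r// addn0 leqW// leq_addr.
case: (leqP n.+1 (2 ^ K)) => nK.
  apply: (@leq_trans ((c + 2 ^ K).+1 ^ K)); last by rewrite leq_pmulr.
  by rewrite leq_wexp2r// leqW// leq_add2l.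
rewrite big_ord_recr /= mulnA.
apply: (@leq_trans ((c + n) ^ K * 2 ^ K)).
  rewrite -expnMn; apply: leq_wexp2r; have : (0 < 2 ^ K)%N by rewrite expn_gt0.
  lia.
apply: leq_mul => //; lia.
Qed.

Lemma bernoulli_ineq (R : realDomainType) (t : R) n :
  0 <= t <= 1 -> 1 - n%:R * t <= (1 - t) ^+ n.
Proof.
move=> /andP[t0 t1]; elim: n => [|n IH]; first by rewrite mul0r subr0 expr0.
apply: (@le_trans _ _ ((1 - t) * (1 - n%:R * t))).
  have n0 : 0 <= n%:R :> R by [].
  by rewrite -natr1; have := mulr_ge0 n0 (mulr_ge0 t0 t0); lra.
by rewrite exprS ler_wpM2l// subr_ge0.
Qed.

Lemma expn_prod K n (F : nat -> nat) :
  ((\prod_(k < n) F k) ^ K = \prod_(k < n) F k ^ K)%N.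
Proof. exact: (big_morph (expn^~ K) (fun x y => expnMn x y K) (exp1n K)). Qed.

Section BlockDigits.
Context {R : realType}.
Context (M r : nat) (M_gt1 : (1 < M)%N).
Implicit Types u v : R.

Definition block_size (k : nat) : nat := ((M + k) ^ r.+1)%N.

Definition block_digit u (k : nat) : nat :=
  ((M + k) ^ r.+2 + radix_digit block_size u k)%N.

Lemma block_size_gt1 k : (1 < block_size k)%N.
Proof.
by rewrite /block_size (@leq_trans (2 ^ r.+1))// ?leq_exp2r ?expnS; lia.
Qed.

Lemma block_digit_ge u k : ((M + k) ^ r.+2 <= block_digit u k)%N.
Proof. exact: leq_addr. Qed.

(** With [a = M + k] and [p = r + 2] this is
[a^p + a^(p-1) = (a + 1) a^(p-1) <= (a + 1)^p]. *)
Lemma block_digit_lt u k : 0 <= u < 1 ->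
  (block_digit u k < (M + k.+1) ^ r.+2)%N.
Proof.
move=> u01; have := radix_digit_lt block_size block_size_gt1 u k u01.
rewrite /block_digit /block_size -(ltn_add2l ((M + k) ^ r.+2)) => /leq_trans.
apply.
rewrite (expnS _ r.+1) addnC -mulSn -addnS (expnS (M + k.+1)).
by rewrite leq_mul// leq_wexp2r//; lia.
Qed.

Lemma block_digit_incr u v k : 0 <= u < 1 ->
  (block_digit u k < block_digit v k.+1)%N.
Proof.
by move=> u01; apply: leq_trans (block_digit_lt u k u01) (block_digit_ge _ _).
Qed.

Lemma block_digit_gt1 u k : (1 < block_digit u k)%N.
Proof.
apply: leq_trans (block_digit_ge u k).
by rewrite (@leq_trans (2 ^ r.+2))// ?leq_exp2r ?expnS; lia.
Qed.

(** This is [pierce_sum_separation] with every digit replaced by an upper bound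
that is a power [p = r + 2].  A digit of index [k < n] is below [(M + k + 1)^p];
the shift from [M + k] to [M + k + 1] in the product costs at most a factor
[M + n], and together with the three further digits this gives the fourth
power. *)
Lemma block_separation u v n : 0 <= u < 1 -> 0 <= v < 1 ->
  (forall k, (k < n)%N -> block_digit u k = block_digit v k) ->
  (block_digit u n < block_digit v n)%N ->
  ((\prod_(k < n) (M + k) * (M + 2 + n) ^ 4) ^ r.+2)%:R^-1 <=
    `|pierce_sum (block_digit u) - pierce_sum (block_digit v) : R|.
Proof.
move=> u01 v01 uv lt; apply: le_trans (@pierce_sum_separation _ _ _ n
  (block_digit_gt1 u) (block_digit_gt1 v) uv lt (block_digit_incr _ _ _ v01)).
have P0 : (0 < \prod_(k < n) block_digit u k)%N.
  by rewrite prodn_gt0// => k; exact/ltnW/block_digit_gt1.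
have D0 w k : (0 < block_digit w k)%N by exact/ltnW/block_digit_gt1.
have PM : (0 < \prod_(k < n) (M + k))%N.
  by rewrite prodn_gt0// => k; rewrite addn_gt0 ltnW.
have Q0 : (0 < (\prod_(k < n) (M + k) * (M + 2 + n) ^ 4) ^ r.+2)%N.
  by rewrite expn_gt0 muln_gt0 PM expn_gt0; apply/orP; left; lia.
rewrite lef_pV2 ?posrE ?ltr0n//; last by rewrite !muln_gt0 P0 !D0.
rewrite ler_nat.
have -> : ((\prod_(k < n) (M + k) * (M + 2 + n) ^ 4) ^ r.+2 =
  (\prod_(k < n) (M + k) * (M + 2 + n)) ^ r.+2 * ((M + 2 + n) ^ r.+2 *
   (M + 2 + n) ^ r.+2 * (M + 2 + n) ^ r.+2))%N.
  by rewrite -!expnMn; congr (_ ^ _)%N; rewrite !expnS expn0; lia.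
apply: leq_mul; last first.
  have le_last w k : 0 <= w < 1 -> (k <= n.+1)%N ->
      (block_digit w k <= (M + 2 + n) ^ r.+2)%N.
    move=> w01 kn; apply: leq_trans (ltnW (block_digit_lt w k w01)) _.
    by rewrite leq_wexp2r//; lia.
  by rewrite !leq_mul// le_last.
apply: (@leq_trans ((\prod_(k < n) (M + k.+1)) ^ r.+2)).
  rewrite (expn_prod _ _ (fun k => M + k.+1)%N).
  by apply: leq_prod => k _; exact/ltnW/block_digit_lt.
apply: leq_wexp2r; apply: (@leq_trans (\prod_(k < n) (M + k) * (M + n))).
  have <- : (M * \prod_(k < n) (M + k.+1) = \prod_(k < n) (M + k) * (M + n))%N.
    transitivity (\prod_(k < n.+1) (M + k))%N; last by rewrite big_ord_recr.
    by rewrite big_ord_recl /= addn0.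
  by rewrite leq_pmull// ltnW.
by rewrite leq_mul//; lia.
Qed.

(** Let [P] be the product of the [M + k], [k < n], and [Y = P (M + 2 + n)^4].
The inverse of [Y^(r+2)] bounds the distance of the images from below, so its
power [s] is at least the inverse of [Y^r].  As [Y^r] exceeds [P^r] only by a
polynomial in [n], it is at most a constant times [P^(r+1)], the product of the
bases. *)
Lemma block_holder (s : R) : 0 <= s -> s * r.+2%:R <= r%:R ->
  exists2 C : R, 0 < C & forall u v, 0 <= u < 1 -> 0 <= v < 1 -> u != v ->
    `|u - v| <=
      C * `|pierce_sum (block_digit u) - pierce_sum (block_digit v)| `^ s.
Proof.
move=> s0 sr; have [C C0 CP] := poly_le_rising (4 * r) (M + 2) M (ltnW M_gt1).
exists C%:R; first by rewrite ltr0n.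
move=> u v u01 v01 uv.
have [n agree differ] := radix_first_diff _ block_size_gt1 u v u01 v01 uv.
apply: le_trans (radix_dist_le _ block_size_gt1 u v n u01 v01 agree) _.
set P := (\prod_(k < n) (M + k))%N.
set Y := (P * (M + 2 + n) ^ 4)%N.
have P0 : (0 < P)%N by rewrite prodn_gt0// => k; rewrite addn_gt0 ltnW.
have Y0 : (0 < Y)%N by rewrite muln_gt0 P0 expn_gt0; lia.
have sep : (Y ^ r.+2)%:R^-1 <=
    `|pierce_sum (block_digit u) - pierce_sum (block_digit v) : R|.
  have := differ; rewrite neq_ltn => /orP[lt|lt].
    apply: block_separation => //; last by rewrite /block_digit ltn_add2l.
    by move=> k kn; rewrite /block_digit agree.
  rewrite distrC; apply: block_separation => //; last first.
    by rewrite /block_digit ltn_add2l.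
  by move=> k kn; rewrite /block_digit agree.
have Y1 : 1 <= Y%:R :> R by rewrite ler1n.
have Yp : (0 : R) < Y%:R by rewrite ltr0n.
apply: (@le_trans _ _ (C%:R * (Y ^ r)%:R^-1)).
  rewrite ler_pdivlMr ?ltr0n ?expn_gt0 ?Y0// mulrC ler_pdivrMr; last first.
    by rewrite ltr0n prodn_gt0// => k; apply/ltnW/block_size_gt1.
  rewrite -natrM ler_nat -(expn_prod _ _ (fun k => M + k)%N) expnS -/P.
  rewrite expnMn mulnA -expnM.
  by rewrite mulnC leq_mul// CP.
rewrite ler_pM2l ?ltr0n//.
apply: (@le_trans _ _ ((Y ^ r.+2)%:R^-1 `^ s)); last first.
  by apply: ge0_ler_powR => //; rewrite ?nnegrE ?invr_ge0.
rewrite !natrX -!powR_invn ?ler0n// -powRrM.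
by apply: ler_powR => //; lra.
Qed.

(** With [A = M + n + 2] and [t = 2 / A], the block of index [n] starts at
[(A (1 - t))^p], which by Bernoulli's inequality is at least
[A^p (1 - p t) >= A^p / kappa]. *)
Lemma block_ratio (kappa : R) u n : 1 < kappa -> 0 <= u < 1 ->
  r.+2%:R * (2 / (M + 2)%:R) <= 1 - kappa^-1 ->
  (block_digit u n.+1)%:R <= kappa * (block_digit u n)%:R.
Proof.
move=> k1 u01 hM; have k0 : 0 < kappa by exact: lt_trans k1.
apply: (@le_trans _ _ ((M + n.+2) ^ r.+2)%:R).
  by rewrite ler_nat ltnW// block_digit_lt.
apply: (@le_trans _ _ (kappa * ((M + n) ^ r.+2)%:R)); last first.
  by rewrite ler_pM2l// ler_nat block_digit_ge.
rewrite !natrX; set A := (M + n.+2)%:R : R.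
have A2 : 2 <= A by rewrite ler_nat; lia.
have A0 : 0 < A by apply: lt_le_trans A2.
have t01 : 0 <= 2 / A <= 1.
  by rewrite ler_pdivrMr// mul1r A2 andbT divr_ge0// ltW.
have := bernoulli_ineq _ _ r.+2 t01.
have h : r.+2%:R * (2 / A) <= 1 - kappa^-1.
  apply: le_trans hM; rewrite ler_pM2l ?ltr0n// ler_pM2l ?ltr0n//.
  have M0 : (0 : R) < (M + 2)%:R by rewrite ltr0n addn2.
  by rewrite lef_pV2 ?posrE// /A ler_nat leq_add2l.
have -> : (M + n)%:R = A * (1 - 2 / A).
  rewrite mulrBr mulr1 mulrCA divff ?mulr1 ?gt_eqF// /A.
  by rewrite !addnS -[(M + n).+2]addn2 (natrD _ (M + n)) addrK.
rewrite exprMn [in X in _ -> X]mulrCA => hb.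
apply: ler_peMr; first by rewrite exprn_ge0// ltW.
rewrite mulrC -ler_pdivrMr// div1r; lra.
Qed.

End BlockDigits.

(** * The dimension of the set *)

Lemma pierce_ratio_le_sub01 (R : realType) (kappa : R) :
  pierce_ratio_le kappa `<=` `[0, 1[.
Proof.
move=> x [/andP[x0 x1] irr _] /=; rewrite in_itv/= ltW//= lt_neqAle x1 andbT.
by apply/eqP => x1E; apply: irr; exists 1 => //; rewrite rmorph1.
Qed.

Lemma pierce_ratio_le_set0 (R : realType) (kappa : R) : kappa <= 1 ->
  pierce_ratio_le kappa = set0.
Proof.
move=> k1; apply/seteqP; split => // x [x01 irr /(_ 1%N isT)].
have /andP[d0 d12] := pierce_digit2_gt x x01 irr.
rewrite ler_pdivrMr ?ltr0z// leNgt => /negP; apply.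
apply: (@le_lt_trans _ _ (pierce_digit 1 x)%:~R); last by rewrite ltr_int.
by rewrite ler_piMl// ler0z ltW.
Qed.

Lemma pierce_ratio_le_block (R : realType) (kappa : R) M r (u : R) :
  (1 < M)%N -> 1 < kappa -> 0 <= u < 1 ->
  r.+2%:R * (2 / (M + 2)%:R) <= 1 - kappa^-1 ->
  pierce_ratio_le kappa (pierce_sum (block_digit M r u)).
Proof.
move=> M1 k1 u01 hM.
have dS k := block_digit_incr M r M1 u u k u01.
have d0 := block_digit_gt1 M r M1 u 0.
have /andP[x0 x1] := @pierce_sum_bounds R _ d0 dS.
split.
- apply/andP; split; first by apply: lt_trans x0; rewrite invr_gt0 ltr0n.
  apply: le_trans (ltW x1) _; rewrite invf_le1 ?ler1n ?ltr0n ltnW//.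
- exact: irrational_pierce_sum.
- move=> [//|n] _; rewrite !pierce_digit_sum// -!pmulrn.
  have D0 : (0 : R) < (block_digit M r u n)%:R.
    by rewrite ltr0n; exact/ltnW/block_digit_gt1.
  by rewrite ler_pdivrMr//; exact: block_ratio.
Qed.

Lemma hausdorff_measure_pierce_ratio_le (R : realType) (kappa s : R) :
  1 < kappa -> 0 <= s < 1 -> hausdorff_measure s (pierce_ratio_le kappa) != 0%E.
Proof.
move=> k1 /andP[s0 s1].
have s10 : 0 < 1 - s by rewrite subr_gt0.
have c0 : 0 < 1 - kappa^-1 by rewrite subr_gt0 invf_lt1// (lt_trans ltr01).
(* This r makes r (1 - s) >= 2 s, that is s (r + 2) <= r. *)
pose r := (Num.truncn (2 * s / (1 - s))).+1.
have sr : s * r.+2%:R <= r%:R.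
  have : 2 * s / (1 - s) <= r%:R by exact/ltW/truncnS_gt.
  rewrite ler_pdivrMr// -[r.+2]addn2 natrD; lra.
pose M := (Num.truncn (r.+2%:R * 2 / (1 - kappa^-1))).+2.
have hM : r.+2%:R * (2 / (M + 2)%:R) <= 1 - kappa^-1.
  rewrite mulrA ler_pdivrMr ?ltr0n// [leRHS]mulrC -ler_pdivrMr//.
  apply: le_trans (ltW (truncnS_gt _)) _.
  by rewrite ler_nat (leq_trans (leqnSn _))// leq_addr.
have [C C0 CP] := block_holder M r isT s s0 sr.
apply: hausdorff_measure_holder_image s0 C0 _ CP => u u01.
exact: pierce_ratio_le_block.
Qed.

Theorem corollary1p10 (R : realType) (kappa : R) :
  (1 < kappa -> hausdorff_dim (pierce_ratio_le kappa) = 1%E) /\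
  (kappa <= 1 -> pierce_ratio_le kappa = set0 /\
                 hausdorff_dim (pierce_ratio_le kappa) = 0%E).
Proof.
split=> [k1|k1]; last first.
  by rewrite pierce_ratio_le_set0// hausdorff_dim_set0.
apply/eqP; rewrite eq_le hausdorff_dim_le1/=; last exact: pierce_ratio_le_sub01.
by apply: hausdorff_dim_ge1 => s; exact: hausdorff_measure_pierce_ratio_le.
Qed.
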